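(* Let $n$ be a positive integer, and let $\operatorname{Alt}_n$ be the set of alternating permutations in the symmetric group $\mathfrak{S}_n$, partially ordered by the (left) weak order. Then the characteristic polynomial of $\operatorname{Alt}_n$ is \[ \chi_{\operatorname{Alt}_n}(q)=q^{\binom{n-1}{2}-\lfloor n/2\rfloor}(q-1)^{\lfloor n/2\rfloor}. \]
   Context: $\mathfrak{S}_n$ is the group of permutations of $[n]=\{1,\dots,n\}$, written $\pi=\pi_1\pi_2\cdots\pi_n$ with $\pi_i=\pi(i)$. It is a Coxeter group (type $A_{n-1}$) with generators $S=\{s_1,\dots,s_{n-1}\}$, where $s_i$ exchanges $i$ and $i+1$; $\ell(\pi)$ is the minimal number of generators in an expression of $\pi$ as a product of generators. Products are compositions of functions, so $s_i\pi$ is obtained from $\pi$ by exchanging the values $i$ and $i+1$. The (left) weak order: $u\le w$ if $w=s_{i_k}\cdots s_{i_1}u$ for some generators with $\ell(s_{i_j}\cdots s_{i_1}u)=\ell(u)+j$ for $0\le j\le k$. A permutation $\pi\in\mathfrak{S}_n$ is alternating if $\pi_1<\pi_2>\pi_3<\cdots$. $\operatorname{Alt}_n$ carries the order induced from the weak order on $\mathfrak{S}_n$. For a finite ranked poset $P$ with bottom element $\hat 0$ (all maximal chains have the same length, where a chain with $m+1$ elements has length $m$), let $r_P$ be the rank function ($r_P(\hat 0)=0$, and $r_P(y)=r_P(x)+1$ if $y$ covers $x$), let $r_P(P)$ be the length of a maximal chain, and let $\mu_P$ be the Möbius function, defined by $\sum_{x\le t\le y}\mu_P(x,t)=\delta_{x,y}$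 for all $x\le y$ (where $\delta_{x,y}$ is $1$ if $x=y$ and $0$ otherwise). The characteristic polynomial of $P$ is $\chi_P(q)=\sum_{t\in P}\mu_P(\hat 0,t)\,q^{r_P(P)-r_P(t)}$.
   Formalization: The case n = 2 is excluded: there Alt_2 is a single point with characteristic polynomial 1, while the stated formula would give q^{-1}(q-1), which is not a polynomial. *)

(* Defs.v *)
From HB Require Import structures.
From mathcomp Require Import all_boot all_order all_algebra all_fingroup.

Set Implicit Arguments.
Unset Strict Implicit.
Unset Printing Implicit Defensive.

Import Order.TTheory GRing.Theory.

Section FinitePosets.

Context {d : Order.disp_t} {T : finPOrderType d}.
Implicit Types (x y t : T) (C : {set T}).

Local Open Scope order_scope.

Definition covers x y := (x < y) && [forall t, ~~ (x < t < y)].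

Definition is_bottom x := [forall y, x <= y].

Definition is_chain C := [forall x in C, forall y in C, x >=< y].

Definition ranked_of_length (m : nat) :=
  forall C, maxset is_chain C -> #|C| = m.+1.

Definition is_rank (b : T) (r : T -> nat) :=
  r b = 0%N /\ forall x y, covers x y -> r y = (r x).+1.

(* The values of mu at pairs that are not in the order relation are
   unconstrained; they do not occur in the characteristic polynomial. *)
Definition is_moebius (mu : T -> T -> int) :=
  forall x y, x <= y ->
    (\sum_(t | (x <= t <= y)%O) mu x t = (x == y)%:R)%R.

End FinitePosets.

(* The graph of the characteristic polynomial: it holds for no p unless T is
   ranked and has a bottom element, and then for exactly one p (see
   [is_char_poly_uniq]). *)
Definition is_char_poly {d : Order.disp_t} (T : finPOrderType d)
    (p : {poly int}) : Prop :=
  exists (b : T) (m : nat) (r : T -> nat) (mu : T -> T -> int),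
    [/\ is_bottom b, @ranked_of_length d T m, is_rank b r, is_moebius mu
      & (p = \sum_(t : T) mu b t *: 'X^(m - r t))%R].

Section CharPolyUnique.

Context {d : Order.disp_t} {T : finPOrderType d}.
Implicit Types (x y t b : T) (C : {set T}).

Local Open Scope order_scope.

Lemma card_below x y : x < y -> (#|[set t | (t < x)%O]| < #|[set t | (t < y)%O]|)%N.
Proof.
move=> xy; apply: proper_card; apply/properP; split.
  by apply/subsetP => t; rewrite !inE => /lt_trans; apply.
by exists x; rewrite !inE ?ltxx.
Qed.

Lemma below_ind (P : T -> Prop) :
  (forall y, (forall x, x < y -> P x) -> P y) -> forall y, P y.
Proof.
move=> IH y; have [n] := ubnP #|[set t | t < y]|.
elim: n y => // n IHn y le_yn; apply: IH => x xy; apply: IHn.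
exact: leq_trans (card_below xy) le_yn.
Qed.

Lemma ex_covers b y : b < y -> exists x, covers x y.
Proof.
move=> lt_by.
have [x xy xmax] := @arg_maxnP _ b (fun x => x < y)
  (fun x => #|[set t | t < x]|) lt_by.
exists x; rewrite /covers xy; apply/forallP => t; apply/negP => /andP[xt ty].
by have := leq_trans (card_below xt) (xmax t ty); rewrite ltnn.
Qed.

Lemma is_rank_uniq b (r1 r2 : T -> nat) :
  is_bottom b -> is_rank b r1 -> is_rank b r2 -> r1 =1 r2.
Proof.
move=> /forallP bot [r1b r1S] [r2b r2S].
apply: below_ind => y IH; have := bot y; rewrite le_eqVlt => /predU1P[<-|by_].
  by rewrite r1b.
have [x cxy] := ex_covers by_.
by rewrite (r1S _ _ cxy) (r2S _ _ cxy) IH //; case/andP: cxy.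
Qed.

Lemma is_moebius_uniq (mu1 mu2 : T -> T -> int) :
  is_moebius mu1 -> is_moebius mu2 ->
  forall x y, x <= y -> mu1 x y = mu2 x y.
Proof.
move=> m1 m2 x; apply: below_ind => y IH xy.
have := etrans (m1 x y xy) (esym (m2 x y xy)).
rewrite (bigD1 y) ?xy ?lexx //= [in RHS](bigD1 y) ?xy ?lexx //=.
rewrite (eq_bigr (mu2 x)) => [/addIr //|t /andP[/andP[xt ty] nty]].
by apply: IH => //; rewrite lt_neqAle nty.
Qed.

Lemma is_char_poly_uniq (p1 p2 : {poly int}) :
  is_char_poly T p1 -> is_char_poly T p2 -> p1 = p2.
Proof.
move=> [b1 [m1 [r1 [mu1 [bot1 rk1 r1P mu1P ->]]]]].
move=> [b2 [m2 [r2 [mu2 [bot2 rk2 r2P mu2P ->]]]]].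
have eb : b1 = b2.
  by apply: le_anti; rewrite (forallP bot1) (forallP bot2).
case: _ / eb in bot2 r2P *.
have em : m1 = m2.
  have c0 : is_chain (set0 : {set T}) by apply/forallP => x; rewrite inE.
  have [C maxC _] := maxset_exists c0.
  by apply/succn_inj; rewrite -(rk1 C) ?(rk2 C).
apply: eq_bigr => t _; rewrite em (is_rank_uniq bot1 r1P r2P).
by rewrite (is_moebius_uniq mu1P mu2P) // (forallP bot1).
Qed.

End CharPolyUnique.

(* [n] is modelled by 'I_n, i.e. positions and values are shifted by one. *)
Section WeakOrder.

Variable n : nat.
Implicit Types (u w s : 'S_n).

Local Open Scope group_scope.

Definition simple_refl : {set 'S_n} :=
  [set tperm i j | i in 'I_n, j in [pred j : 'I_n | j == i.+1 :> nat]].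

Definition expressible w (k : nat) :=
  [exists e : k.-tuple 'S_n, all (mem simple_refl) e && (w == \prod_(s <- e) s)].

Lemma expressibleP w k :
  reflect (exists e : seq 'S_n,
             [/\ size e = k, all (mem simple_refl) e & w = \prod_(s <- e) s])
          (expressible w k).
Proof.
apply: (iffP existsP) => [[e /andP[ae /eqP we]]|[e [se ae we]]].
  by exists e; rewrite size_tuple.
have se' : size e == k by apply/eqP.
by exists (Tuple se'); rewrite /= ae we eqxx.
Qed.

Lemma gen_simple_refl : <<simple_refl>> = [set: 'S_n].
Proof.
apply/eqP; rewrite eqEsubset subsetT /=.
have gen_lt k (i j : 'I_n) : j = (i + k.+1)%N :> nat ->
    tperm i j \in <<simple_refl>>.
  elim: k i j => [|k IHk] i j ij.
    apply: mem_gen; apply/imset2P; exists i j => //.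
    by rewrite inE ij addn1.
  have lt_n : (i + k.+1 < n)%N by rewrite (leq_trans _ (ltn_ord j)) // ij -addnS.
  pose m : 'I_n := Ordinal lt_n.
  have im : i != m by rewrite -val_eqE /= -[X in X != _]addn0 eqn_add2l.
  have ij' : i != j by rewrite -val_eqE /= ij -[X in X != _]addn0 eqn_add2l.
  have mj : m != j by rewrite -val_eqE /= ij eqn_add2l neq_ltn ltnSn.
  have -> : tperm i j = tperm i m ^ tperm m j.
    by rewrite tpermJ tpermL tpermD // eq_sym.
  apply: groupJ; first exact: IHk.
  apply: mem_gen; apply/imset2P; exists m j => //.
  by rewrite inE /= ij -addnS.
apply/subsetP => w _; have [ts -> _] := prod_tpermP w.
rewrite group_prod // => t _.
case: (ltngtP t.1 t.2) => [lt|gt|/val_inj ->]; last by rewrite tperm1 group1.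
  by apply: (gen_lt (t.2 - t.1.+1)%N); rewrite addnS -addSn subnKC.
rewrite tpermC.
by apply: (gen_lt (t.1 - t.2.+1)%N); rewrite addnS -addSn subnKC.
Qed.

Lemma ex_expressible w : exists k, expressible w k.
Proof.
have : w \in <<simple_refl>> by rewrite gen_simple_refl inE.
case/gen_prodgP => k [c cS ->]; exists k; apply/expressibleP.
exists [seq c i | i <- index_enum 'I_k].
rewrite size_map; split; last by rewrite big_map.
  by rewrite -[LHS]sum1_size sum1_card card_ord.
by apply/allP => s /mapP[i _ ->]; apply: cS.
Qed.

Definition coxeter_length w : nat := ex_minn (ex_expressible w).

(* In MathComp (u * s) i = s (u i), so that the product "s u" of functions, in
   which s acts on the values of u, is written u * s. *)
Definition weak_step : rel 'S_n := fun u w =>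
  [exists s in simple_refl,
     (w == u * s) && (coxeter_length w == (coxeter_length u).+1)].

Definition weak_le : rel 'S_n := connect weak_step.

Lemma weak_leP u w :
  reflect (exists e : seq 'S_n,
             [/\ all (mem simple_refl) e, w = u * \prod_(s <- e) s
               & forall j, (j <= size e)%N ->
                   coxeter_length (u * \prod_(s <- take j e) s)
                     = (coxeter_length u + j)%N])
          (weak_le u w).
Proof.
apply: (iffP connectP) => [[p pth ->]|[e [ae -> len]]].
  elim: p u pth => [|v p IHp] u /=.
    by exists [::]; split=> //= [|[|//] _]; rewrite big_nil mulg1 ?addn0.
  case/andP => /existsP[s /and3P[sS /eqP vE /eqP lv]] /IHp[e [ae -> len]].
  exists (s :: e); split; rewrite /= ?big_cons ?mulgA ?vE //; first exact/andP.
  case=> [|j] lej; first by rewrite big_nil mulg1 addn0.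
  by rewrite big_cons mulgA -vE len // lv addSnnS.
elim: e u ae len => [|s e IHe] u /=.
  by exists [::]; rewrite ?big_nil ?mulg1.
case/andP=> sS ae len.
have l1 : coxeter_length (u * s) = (coxeter_length u).+1.
  by have := len 1%N isT; rewrite /= take0 big_seq1 addn1.
have [j lej|p pth lst] := IHe (u * s) ae.
  by have := len j.+1 lej; rewrite /= big_cons mulgA l1 addSnnS.
exists (u * s :: p) => /=; last by rewrite big_cons mulgA.
by rewrite pth andbT; apply/existsP; exists s; rewrite sS l1 !eqxx.
Qed.

Lemma weak_le_refl : reflexive weak_le.
Proof. exact: connect0. Qed.

Lemma weak_le_trans : transitive weak_le.
Proof. exact: connect_trans. Qed.

Lemma weak_le_anti : antisymmetric weak_le.
Proof.
move=> u w /andP[/weak_leP[e [_ wE len]] /weak_leP[f [_ uE lenf]]].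
have := len _ (leqnn _); rewrite take_size -wE => lw.
have := lenf _ (leqnn _); rewrite take_size -uE lw => /eqP.
rewrite -addnA -[X in X == _]addn0 eqn_add2l eq_sym addn_eq0.
case/andP=> /nilP e0 _.
by rewrite wE e0 big_nil mulg1.
Qed.

(* In the 1-based numbering of the positions, the position i is odd iff the
   0-based index i : 'I_n is even. *)
Definition alternating w :=
  [forall i : 'I_n, forall j : 'I_n, (j == i.+1 :> nat) ==>
     (if odd i then (w j < w i)%N else (w i < w j)%N)].

End WeakOrder.

Fact weak_display : Order.disp_t. Proof. exact: Order.Disp tt tt. Qed.

(* A copy of 'S_n, so that the order below is not inferred for every
   permutation. *)
Definition weakS (n : nat) : Type := 'S_n.

HB.instance Definition _ (n : nat) := Finite.copy (weakS n) 'S_n.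
HB.instance Definition _ (n : nat) :=
  Order.Le_isPOrder.Build weak_display (weakS n)
    (@weak_le_refl n) (@weak_le_anti n) (@weak_le_trans n).

Definition Alt (n : nat) : Type := {w : weakS n | alternating w}.

HB.instance Definition _ (n : nat) :=
  SubFinite.copy (Alt n) {w : weakS n | alternating w}.
HB.instance Definition _ (n : nat) :=
  [SubChoice_isSubPOrder of Alt n by <: with weak_display].

Lemma Alt_leE n (u w : Alt n) : (u <= w)%O = weak_le (val u) (val w).
Proof. by []. Qed.


Lemma is_char_poly_singleton {d : Order.disp_t} (T : finPOrderType d) (b : T) :
  (forall x : T, x = b) -> is_char_poly T 1%R.
Proof.
move=> Tb; exists b, 0%N, (fun=> 0%N), (fun _ _ => 1%R); split.
- by apply/forallP => y; rewrite (Tb y).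
- move=> C /maxsetP[_ maxC].
  have chT : is_chain [set: T].
    rewrite /is_chain; apply/forall_inP => x _; apply/forall_inP => y _.
    by rewrite (Tb x) (Tb y) comparablexx.
  rewrite -(maxC _ chT (subsetT _)); apply/eqP/cards1P; exists b.
  by apply/setP => x; rewrite !inE (Tb x) eqxx.
- by split=> // x y; rewrite /covers (Tb x) (Tb y) ltxx.
- move=> x y _; rewrite (Tb x) (Tb y) eqxx (big_pred1 b) // => t.
  by rewrite (Tb t) !lexx /= eqxx.
- by rewrite (big_pred1 b) ?scale1r // => t; rewrite (Tb t) /= eqxx.
Qed.

(* This is the reason why n = 2 is excluded from the main theorem: the formula
   would read q ^ (-1) * (q - 1), but Alt 2 is a single point. *)
Lemma Alt2_char_poly : is_char_poly (Alt 2) 1%R.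
Proof.
have a1 : alternating (1%g : 'S_2).
  apply/forallP => i; apply/forallP => j; apply/implyP => /eqP ji.
  rewrite !perm1 ji; case: i ji (ltn_ord j) => [[|i] //= i2] ->.
  by rewrite ltnS ltnNge ltnS in i2 *.
apply: (@is_char_poly_singleton _ (Alt 2) (exist _ (1%g : weakS 2) a1)) => -[w aw].
apply: val_inj => /=; apply/permP.
have := implyP (forallP (forallP aw ord0) ord_max) isT => /=.
case E0: (w ord0) => [[|[|//]] i0]; case E1: (w ord_max) => [[|[|//]] i1] //= _.
move=> i; rewrite perm1; apply: val_inj => /=.
case: i => [[|[|//]] i] /=.
  by rewrite (_ : Ordinal i = ord0) ?E0 //; apply: val_inj.
by rewrite (_ : Ordinal i = ord_max) ?E1 //; apply: val_inj.
Qed.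

(* Main.v *)
Require Import Defs.
From mathcomp Require Import all_boot all_order all_algebra all_fingroup.
From mathcomp Require Import zify.

(** Positions and values are counted from 0.  The weak order is the inclusion
order on sets of inversions, an inversion of [w] being a pair of positions
[a < b] with [w b < w a] ([weak_le_inv]).  A permutation is alternating when it
inverts the adjacent pairs [(a, a+1)] with [a] odd and no other adjacent
pairs; non-adjacent pairs are not constrained by this directly.  The
permutation [alt_min = 0 2 1 4 3 ...] has as inversions exactly the adjacent
pairs that every alternating permutation must invert, and [alt_max] has as
non-inversions exactly those that none may invert; so the alternating
permutations form the interval [[alt_min, alt_max]] of the weak order
([alternating_interval]).  Going up one step in this interval adds one
inversion ([inv_subset_step]), so it is ranked by the number of inversions
beyond those of [alt_min], and its length is the number of non-adjacent pairs
of positions, which is the binomial coefficient (n-1 choose 2).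

The atoms are obtained from [alt_min] by exchanging the values [2k] and
[2k+1], for [k < n./2].  Each of these exchanges adds a single inversion
[atom_pair k], and they act on disjoint pairs of values, so any set [J] of them
can be performed at once, giving a permutation [alt_join J] whose inversions
are those of [alt_min] together with the [atom_pair k] for [k] in [J]
([inv_alt_join]).  Hence [alt_join J] is the join of the atoms in [J] and
has rank [#|J|].  Moreover each alternating [w] other than [alt_min] lies above
some atom ([atoms_below_eq0]): otherwise [w] is increasing along the positions
at which [alt_min] takes the values 0, 1, 2, ...  When [n] is 2 the exchange of 0
and 1 inverts two adjacent positions and leaves the interval; for all other [n]
the pairs [atom_pair k] are not adjacent ([atom_pair_far]).

A Moebius function is then forced to be [(-1) ^ #|J|] at [alt_join J] and 0 at
all other elements: summed over the [alt_join J] below [y] these values give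
the sum of the [(-1) ^ #|J|] over the subsets [J] of the set of atoms below [y],
which vanishes unless that set is empty.  Expanding [(q - 1) ^ n./2] over the
subsets [J] gives the formula ([char_poly_of_boolean_joins]). *)

Set Implicit Arguments.
Unset Strict Implicit.
Unset Printing Implicit Defensive.

Import Order.TTheory GRing.Theory.

(** * Ranks and Moebius functions of finite posets *)

Section Posets.
Context {d : Order.disp_t} {T : finPOrderType d}.
Implicit Types (x y z t b : T) (C : {set T}).
Local Open Scope order_scope.

Lemma ex_covers_between x y : x < y -> exists2 z, x <= z & covers z y.
Proof.
move=> xy.
have xP : x <= x < y by rewrite lexx.
have [z /andP[xz zy] zmax] := @arg_maxnP _ x (fun z => x <= z < y)
  (fun z => #|[set t | t < z]|) xP.
exists z => //; rewrite /covers zy; apply/forallP => t; apply/negP => /andP[zt ty].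
have := leq_trans (card_below zt) (zmax t _); rewrite ltnn => /(_ _)/negP [] //.
by rewrite ty (le_trans xz (ltW zt)).
Qed.

Lemma rank_lt b (r : T -> nat) x y : is_rank b r -> x < y -> (r x < r y)%N.
Proof.
case=> _ rS; move: y; apply: below_ind => y IH xy.
have [z xz czy] := ex_covers_between xy; rewrite (rS _ _ czy) ltnS.
move: xz; rewrite le_eqVlt => /predU1P[->//|xz].
by apply/ltnW/IH => //; case/andP: czy.
Qed.

Lemma chain_setU1 C z :
  is_chain C -> (forall x, x \in C -> x >=< z) -> is_chain (z |: C).
Proof.
move=> /forall_inP chC zC; apply/forall_inP => x xC; apply/forall_inP => y.
move: xC; rewrite !inE => /predU1P[->|xC] /predU1P[->|yC].
- exact: comparablexx.
- by rewrite comparable_sym zC.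
- exact: zC.
- by have /forall_inP := chC _ xC; apply.
Qed.

Lemma maxset_chain_mem C z :
  maxset is_chain C -> (forall x, x \in C -> x >=< z) -> z \in C.
Proof.
case/maxsetP => chC maxC zC.
by rewrite -(maxC _ (chain_setU1 chC zC) (subsetUr _ _)) setU11.
Qed.

(** A maximal chain meets every rank: above an element of the chain that is not
[top], the element of the chain of next smallest rank must cover it, for an
element strictly between the two would extend the chain. *)
Lemma ranked_of_rank b top (r : T -> nat) :
  is_bottom b -> (forall y, y <= top) -> is_rank b r ->
  @ranked_of_length d T (r top).
Proof.
move=> /forallP bot topP rk C maxC.
have /maxsetP[/forall_inP chC _] := maxC.
have cmp x y : x \in C -> y \in C -> x >=< y.
  by move=> xC; have /forall_inP := chC _ xC; apply.
have bC : b \in C.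
  by apply: maxset_chain_mem maxC _ => x _; rewrite comparable_sym le_comparable.
have tC : top \in C.
  by apply: maxset_chain_mem maxC _ => x _; rewrite le_comparable.
have rank_mem k : (k <= r top)%N -> exists2 x, x \in C & r x = k.
  elim: k => [|k IHk] lek; first by exists b; rewrite // (proj1 rk).
  have [x xC rx] := IHk (ltnW lek).
  have x_top : x < top.
    rewrite lt_neqAle topP andbT.
    by apply: contraTneq lek => <-; rewrite rx ltnn.
  have topQ : (top \in C) && (x < top) by rewrite tC.
  have [y /andP[yC xy] ymin] :=
    @arg_minnP _ top (fun y => (y \in C) && (x < y)) r topQ.
  exists y; rewrite // -rx; apply: (proj2 rk).
  rewrite /covers xy; apply/forallP => z; apply/negP => /andP[xz zy].
  have zC : z \in C.
    apply: maxset_chain_mem maxC _ => u uC.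
    have /orP[ux|xu] := cmp _ _ uC xC.
      by rewrite le_comparable ?(le_trans ux) ?ltW.
    have /orP[uy|yu] := cmp _ _ uC yC; last first.
      by rewrite comparable_sym le_comparable // (le_trans (ltW zy)).
    have [->|nux] := eqVneq u x; first by rewrite le_comparable ?ltW.
    have [->|nuy] := eqVneq u y.
      by rewrite comparable_sym le_comparable ?ltW.
    have {}xu : x < u by rewrite lt_neqAle eq_sym nux.
    have {}uy : u < y by rewrite lt_neqAle nuy.
    by have := ymin u; rewrite uC xu leqNgt (rank_lt rk uy) => /(_ isT).
  by have := ymin z; rewrite zC xz leqNgt (rank_lt rk zy) => /(_ isT).
have r_inj : {in C &, injective r}.
  move=> x y xC yC rxy; have /orP[] := cmp _ _ xC yC;
    rewrite le_eqVlt => /predU1P[//|].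
    by move/(rank_lt rk); rewrite rxy ltnn.
  by move/(rank_lt rk); rewrite rxy ltnn.
have r_le x : (r x < (r top).+1)%N.
  rewrite ltnS; have := topP x; rewrite le_eqVlt => /predU1P[->//|].
  by move/(rank_lt rk)/ltnW.
rewrite -(card_in_imset (f := fun x => Ordinal (r_le x))); last first.
  by move=> x y xC yC /(congr1 val) /=; apply: r_inj.
rewrite -[RHS]card_ord -cardsT; congr #|pred_of_set _|; apply/setP => k.
rewrite inE; apply/imsetP.
by have [x xC rx] := rank_mem k (ltn_ord k); exists x => //; apply: val_inj.
Qed.

Local Open Scope ring_scope.

(** The recursion defining the Moebius function goes down the order and is not
structural; the fuel [k] bounds its depth. *)
Fixpoint moebius_fuel (k : nat) x y : int :=
  if k is k'.+1 then
    (x == y)%:R - \sum_(t | (x <= t < y)%O) moebius_fuel k' x t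
  else 0.

Lemma moebius_fuel_stable k1 k2 x y :
  (#|[set t | (t < y)%O]| < k1)%N -> (#|[set t | (t < y)%O]| < k2)%N ->
  moebius_fuel k1 x y = moebius_fuel k2 x y.
Proof.
elim: k1 k2 y => // k1 IHk [//|k2] y; rewrite !ltnS => yk1 yk2 /=.
congr (_ - _); apply: eq_bigr => t /andP[_ ty].
by apply: IHk; apply: leq_trans (card_below ty) _.
Qed.

Definition moebius x y := moebius_fuel #|T|.+1 x y.

Lemma moebiusP : is_moebius moebius.
Proof.
have below_card y : (#|[set t | (t < y)%O]| < #|T|)%N.
  rewrite -cardsT; apply: proper_card; apply/properP; split=> //.
  by exists y; rewrite ?inE ?ltxx.
move=> x y xy; rewrite (bigD1 y) ?xy ?lexx //=.
rewrite {1}/moebius /= -addrA [X in _ + X](_ : _ = 0) ?addr0 //.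
apply/eqP; rewrite addrC subr_eq0; apply/eqP.
apply: eq_big => [t|t _].
  by rewrite -andbA [in RHS]lt_neqAle [(_ != _) && _]andbC.
by apply: moebius_fuel_stable; rewrite // ltnS ltnW.
Qed.

(** Here [join J] plays the role of the join of a set [J] of atoms and [A y] that
of the set of atoms below [y], so that the interval from [b] to [join J] contains
the Boolean lattice of the subsets of [J].  The values of the Moebius function
at [b] are read off from the sum of [(-1) ^ #|J|] over the subsets of [A y],
which is 1 or 0 according as [A y] is empty or not. *)
Lemma char_poly_of_boolean_joins (b top : T) (r : T -> nat) (I : finType)
    (join : {set I} -> T) (A : T -> {set I}) :
  is_bottom b -> (forall y, (y <= top)%O) -> is_rank b r ->
  (forall J y, (join J <= y)%O = (J \subset A y)) ->
  (forall y, A y = set0 -> y = b) ->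
  (forall J, r (join J) = #|J|) ->
  is_char_poly T ('X ^+ (r top - #|I|) * ('X - 1) ^+ #|I|).
Proof.
move=> bP topP rk joinP A0 rjoin; have /forallP bot := bP.
have r_le x : (r x <= r top)%N.
  have := topP x; rewrite le_eqVlt => /predU1P[->//|].
  by move/(rank_lt rk)/ltnW.
have Ab : A b = set0.
  have : join (A b) = b by apply: le_anti; rewrite bot joinP subxx.
  by move/(congr1 r); rewrite rjoin (proj1 rk) => /cards0_eq.
(* [join] is injective by [joinP] and [rjoin], so that this sum has at most one
   term; a sum saves the case distinction on whether [y] is a value of [join]. *)
pose f y : int := \sum_(J | join J == y) (-1) ^+ #|J|.
have sum_f (V : lmodType int) (P : pred T) (F : T -> V) :
    \sum_(t | P t) f t *: F t =
      \sum_(J | P (join J)) (-1) ^+ #|J| *: F (join J).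
  rewrite (partition_big join P) //=; apply: eq_bigr => t Pt.
  rewrite scaler_suml; apply: eq_big => [J|J /eqP -> //].
  by case: eqP => [->|]; rewrite ?Pt ?andbF.
(* The product over [i] of [1 - 1] for [i] in [A y] and of [0 + 1] otherwise
   expands to the sum over the subsets of [A y]. *)
have f_sum y : \sum_(t | (b <= t <= y)%O) f t = (b == y)%:R.
  transitivity (\prod_(i : I) ((if i \in A y then -1 else 0) + 1 : int)).
    transitivity (\sum_(t | (b <= t <= y)%O) f t *: (1 : int^o)).
      by apply: eq_bigr => t _; rewrite [RHS]mulr1.
    rewrite sum_f bigA_distr /= big_mkcond.
    apply: eq_bigr => J _; rewrite bot joinP -big_mkcondr /=.
    case: subsetP => [sJA|nsJA].
      rewrite [RHS](eq_bigr (fun=> -1)) ?prodr_const ?[LHS]mulr1 //.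
      by move=> i /sJA ->.
    have [i iJ iA] : exists2 i, i \in J & i \notin A y.
      by apply/subsetPn/subsetP.
    by rewrite (bigD1 i) //= (negPf iA) mul0r.
  have [Ay|[i iA]] := set_0Vmem (A y).
    rewrite (A0 _ Ay) eqxx Ab big1 // => i _.
    by rewrite inE add0r.
  rewrite (bigD1 i) //= iA addNr mul0r.
  by case: eqP iA => // <-; rewrite Ab inE.
exists b, (r top), r, (fun x y => if x == b then f y else moebius x y).
split=> //.
- exact: (ranked_of_rank bP topP rk).
- by move=> x y xy; case: (x =P b) => [->|_]; [apply: f_sum | apply: moebiusP].
rewrite eqxx (sum_f _ predT (fun t => 'X^(r top - r t))) /=.
have leI : (#|I| <= r top)%N by rewrite -cardsT -rjoin.
rewrite -prodr_const addrC bigA_distr /= mulr_sumr; apply: eq_bigr => J _.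
have leJ : (#|J| <= #|I|)%N by exact: max_card.
rewrite (bigID (mem J)) /= (eq_bigr (fun=> -1)) => [|i ->//].
rewrite [\prod_(i | i \notin J) _](eq_bigr (fun=> 'X)) => [|i /negPf ->//].
rewrite !prodr_const mulrCA -exprD rjoin -mul_polyC rmorphXn rmorphN1.
congr (_ * 'X^_); set c := (X in (_ + X)%N).
have cC : (#|J| + c)%N = #|I| := cardC (mem J).
have subE k l j m : (j + l = k -> k <= m -> m - k + l = m - j)%N by lia.
exact: subE cC leI.
Qed.

End Posets.

(** * The weak order is the inclusion of inversion sets *)

Section Inversions.
Variable n : nat.
Implicit Types (u v w s : 'S_n) (i j a b : 'I_n) (p : 'I_n * 'I_n).
Local Open Scope group_scope.

Definition inversions w : {set 'I_n * 'I_n} :=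
  [set p : 'I_n * 'I_n | (p.1 < p.2)%N && (w p.2 < w p.1)%N].

Lemma inv_pairE w a b : ((a, b) \in inversions w) = (a < b)%N && (w b < w a)%N.
Proof. by rewrite inE. Qed.

Lemma perm_lt_total w a b : a != b -> (w a < w b)%N = ~~ (w b < w a)%N.
Proof.
by move=> ab; rewrite -leqNgt ltn_neqAle (inj_eq val_inj) (inj_eq perm_inj) ab.
Qed.

Lemma tperm_adj_lt i j a b : j = i.+1 :> nat ->
  (tperm i j b < tperm i j a)%N =
    (a == i) && (b == j) || (b < a)%N && ~~ ((a == j) && (b == i)).
Proof.
move=> ij; rewrite -!val_eqE.
case: tpermP => [->|->|/eqP + /eqP +]; case: tpermP => [->|->|/eqP + /eqP +];
  rewrite -?val_eqE /=; lia.
Qed.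

(** Exchanging the values [i] and [i+1] affects no comparison of values other
than that between [i] and [i+1] themselves. *)
Lemma inv_mul_tperm u i j : j = i.+1 :> nat -> (u^-1 i < u^-1 j)%N ->
  inversions (u * tperm i j) = (u^-1 i, u^-1 j) |: inversions u.
Proof.
move=> ij lt_ij; apply/setP => -[a b].
rewrite in_setU1 !inv_pairE !permM tperm_adj_lt // xpair_eqE.
rewrite !(can2_eq (permK u) (permKV u)).
have up : (a == u^-1 i) && (b == u^-1 j) -> (a < b)%N.
  by case/andP=> /eqP-> /eqP->.
have down : (a == u^-1 j) && (b == u^-1 i) -> ~~ (a < b)%N.
  by case/andP=> /eqP-> /eqP->; rewrite -leqNgt ltnW.
move: up down; case: (_ && _) => [-> //|_].
case: (_ && _) => [/(_ isT)/negPf-> //|_].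
by rewrite andbT.
Qed.

Lemma perm_adj_lt_eq1 v :
  (forall i j, j = i.+1 :> nat -> (v i < v j)%N) -> v = 1.
Proof.
move=> vS.
have ge k i : i = k :> nat -> (i <= v i)%N.
  elim: k i => [|k IHk] i ik; first by rewrite ik.
  have lt_kn : (k < n)%N by rewrite (leq_trans _ (ltn_ord i)) // ik.
  have := vS (Ordinal lt_kn) i ik; have := IHk (Ordinal lt_kn) erefl.
  rewrite /=; lia.
have le k i : (n - i = k)%N -> (v i <= i)%N.
  elim: k i => [|k IHk] i ik; first by have := ltn_ord i; lia.
  have [lt_in|] := ltnP i.+1 n; last by have := ltn_ord (v i); lia.
  have := vS i (Ordinal lt_in) erefl; have := IHk (Ordinal lt_in).
  rewrite /=; lia.
apply/permP => i; apply: val_inj; rewrite perm1 /=.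
by apply/eqP; rewrite eqn_leq (le _ _ erefl) (ge _ _ erefl).
Qed.

Lemma eq_perm_adj_lt u w :
  (forall i j, j = i.+1 :> nat -> (w (u^-1 i) < w (u^-1 j))%N) -> u = w.
Proof.
move=> uw; apply: (mulgI u^-1); rewrite mulVg; apply/esym/perm_adj_lt_eq1.
by move=> i j ij; rewrite !permM uw.
Qed.

Lemma mem_simple_refl s :
  reflect (exists i, exists2 j : 'I_n, j = i.+1 :> nat & s = tperm i j)
          (s \in @simple_refl n).
Proof.
apply: (iffP imset2P) => [[i j _] | [i [j ij ->]]].
  by rewrite inE => /eqP ij ->; exists i, j.
by exists i j; rewrite ?inE ?ij.
Qed.

(** If no exchange of values [i] and [i+1] went up from [u] within the
inversions of [w], then, [w] having all inversions of [u], the permutation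
[u^-1 * w] would be increasing, hence trivial. *)
Lemma inv_subset_step u w : inversions u \subset inversions w -> u != w ->
  exists s p, [/\ s \in @simple_refl n, p \notin inversions u,
    inversions (u * s) = p |: inversions u
    & inversions (u * s) \subset inversions w].
Proof.
move=> /subsetP uw neq_uw.
have [[i j]] : exists x : 'I_n * 'I_n,
    (x.2 == x.1.+1 :> nat) && ~~ (w (u^-1 x.1) < w (u^-1 x.2))%N.
  apply/existsP; apply: contraNT neq_uw; rewrite negb_exists => /forallP uwS.
  apply/eqP/eq_perm_adj_lt => i j /eqP ij.
  by have := uwS (i, j); rewrite /= ij negbK.
case/andP=> /= /eqP ij; rewrite -leqNgt leq_eqVlt.
rewrite (inj_eq val_inj) !(inj_eq perm_inj) -val_eqE /= ij gtn_eqF //= => wij.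
have lt_ij : (u^-1 i < u^-1 j)%N.
  rewrite ltnNge leq_eqVlt (inj_eq val_inj) (inj_eq perm_inj) -val_eqE /= ij.
  rewrite gtn_eqF //=; apply/negP => lt_ji.
  have /uw : (u^-1 j, u^-1 i) \in inversions u.
    by rewrite inv_pairE lt_ji !permKV ij /=.
  by rewrite inv_pairE => /andP[_]; rewrite ltnNge (ltnW wij).
exists (tperm i j), (u^-1 i, u^-1 j); split.
- by apply/mem_simple_refl; exists i, j.
- by rewrite inv_pairE !permKV ij [X in _ && X]ltnNge leqnSn andbF.
- exact: inv_mul_tperm.
rewrite inv_mul_tperm // subUset sub1set inv_pairE lt_ij wij.
exact/subsetP.
Qed.

(** Repeating [inv_subset_step] climbs from [u] to [w].  For [u = 1] this also
writes [w] as a product of as many generators as [w] has inversions. *)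
Lemma inv_subset_path u w : inversions u \subset inversions w ->
  exists e : seq 'S_n, [/\ all (mem (@simple_refl n)) e,
    w = u * \prod_(s <- e) s
    & forall k, (k <= size e)%N ->
        #|inversions (u * \prod_(s <- take k e) s)| = (#|inversions u| + k)%N].
Proof.
have [m] := ubnP (#|inversions w| - #|inversions u|).
elim: m u => // m IHm u le_m uw.
have [->|neq_uw] := eqVneq u w.
  by exists [::]; split=> //= [|[]// _]; rewrite big_nil mulg1 ?addn0.
have [s [p [sS pu us usw]]] := inv_subset_step uw neq_uw.
have cus : #|inversions (u * s)| = #|inversions u|.+1 by rewrite us cardsU1 pu.
have [|e [eS wE ek]] := IHm (u * s) _ usw.
  by have := subset_leq_card usw; rewrite cus; move: le_m; lia.
exists (s :: e); split; rewrite /= ?sS ?big_cons ?mulgA //.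
case=> [|k] le_k; first by rewrite big_nil mulg1 addn0.
by rewrite big_cons mulgA ek // cus addSnnS.
Qed.

Lemma inv1 : inversions 1 = set0.
Proof. by apply/setP => -[a b]; rewrite !inE !perm1 /=; lia. Qed.

Lemma inv_mul_simple u s : s \in @simple_refl n ->
  (exists2 p, p \notin inversions u & inversions (u * s) = p |: inversions u) \/
  (exists2 p, p \notin inversions (u * s) &
     inversions u = p |: inversions (u * s)).
Proof.
case/mem_simple_refl => i [j ij ->].
have [lt_ij|le_ji] := ltnP (u^-1 i) (u^-1 j); [left|right].
  exists (u^-1 i, u^-1 j); last exact: inv_mul_tperm.
  by rewrite inv_pairE !permKV ij [X in _ && X]ltnNge leqnSn andbF.
have lt_ji : (u^-1 j < u^-1 i)%N.
  rewrite ltn_neqAle le_ji andbT (inj_eq val_inj) (inj_eq perm_inj) -val_eqE /=.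
  by rewrite ij gtn_eqF.
exists (u^-1 j, u^-1 i).
  rewrite inv_pairE !permM !permKV tpermL tpermR ij.
  by rewrite [X in _ && X]ltnNge leqnSn andbF.
have := @inv_mul_tperm (u * tperm i j) i j ij.
by rewrite -mulgA tperm2 mulg1 invMg tpermV !permM tpermL tpermR; apply.
Qed.

Lemma coxeter_length_inv w : coxeter_length w = #|inversions w|.
Proof.
rewrite /coxeter_length; case: ex_minnP => k /expressibleP[e [<- eS wE]] kmin.
apply/eqP; rewrite eqn_leq; apply/andP; split.
  have : inversions 1 \subset inversions w by rewrite inv1 sub0set.
  case/inv_subset_path=> f [fS wf fk].
  apply: kmin; apply/expressibleP; exists f.
  split=> //; last by rewrite wf mul1g.
  by have := fk _ (leqnn _); rewrite take_size -wf inv1 cards0.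
rewrite {}wE {kmin}; elim/last_ind: e eS => [|e s IHe].
  by rewrite big_nil inv1 cards0.
rewrite all_rcons size_rcons big_rcons /= => /andP[sS /IHe].
have [[p pu ->]|[p pu ->]] := inv_mul_simple (\prod_(t <- e) t) sS.
  by rewrite cardsU1 pu.
by rewrite cardsU1 pu add1n => /ltnW; apply: leqW.
Qed.

Lemma weak_le_inv u w : weak_le u w = (inversions u \subset inversions w).
Proof.
apply/idP/idP => [/connectP[e]|/inv_subset_path[e [eS we ek]]]; last first.
  by apply/weak_leP; exists e; split=> // k ke; rewrite !coxeter_length_inv ek.
elim: e u => [|v e IHe] u /=; first by move=> _ ->.
case/andP=> /existsP[s /and3P[sS /eqP -> /eqP]] + + we => lus /IHe.
move/(_ we); apply: subset_trans.
move: lus; rewrite !coxeter_length_inv.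
have [[p _ ->] _|[p pu ->]] := inv_mul_simple u sS; first exact: subsetUr.
by rewrite cardsU1 pu; lia.
Qed.

End Inversions.

(** * Alternating permutations as an interval of the weak order *)

Section AlternatingInterval.
Variable n : nat.
Implicit Types (u v w : 'S_n) (i j a b : 'I_n) (c : bool).

Lemma alternatingP w :
  reflect (forall i j, j = i.+1 :> nat -> ((i, j) \in inversions w) = odd i)
          (alternating w).
Proof.
apply: (iffP forallP) => [altw i j ij|altw i].
  have /forallP/(_ j)/implyP/(_ (introT eqP ij)) := altw i.
  rewrite inv_pairE ij ltnSn /=; case: odd => // lt_ij.
  by rewrite ltnNge ltnW.
apply/forallP => j; apply/implyP => /eqP ij; have := altw i j ij.
rewrite inv_pairE ij ltnSn /=; case: odd => [-> //|].
by move=> nij; rewrite perm_lt_total ?nij // -val_eqE /= ij ltn_eqF.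
Qed.

(** The involution of [{0, ..., n-1}] that exchanges [i] and [i+1] for every [i]
with [odd i = c]; a number whose partner falls outside the range is fixed. *)
Definition paired c (i : nat) : nat :=
  if odd i == c then (if i.+1 < n then i.+1 else i) else i.-1.

Lemma paired_subproof c i : paired c i < n.
Proof.
by have := ltn_ord i; rewrite /paired; case: c; repeat case: ifP; lia.
Qed.

Lemma pairedK c (i : nat) : i < n -> paired c (paired c i) = i.
Proof. by rewrite /paired; case: c; repeat case: ifP; lia. Qed.

Definition pairing c i : 'I_n := Ordinal (paired_subproof c i).

Lemma pairingK c : involutive (pairing c).
Proof. by move=> i; apply: val_inj; rewrite /= pairedK. Qed.

Lemma paired_lt c (a b : nat) : a < b -> b < n ->
  (paired c b < paired c a) = (odd a == c) && (b == a.+1).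
Proof. by rewrite /paired; case: c; repeat case: ifP; lia. Qed.

Definition alt_min : 'S_n := perm (can_inj (pairingK true)).

(** For [n = 7] the values are 5 6 3 4 1 2 0. *)
Definition alt_max : 'S_n :=
  perm (inj_comp rev_ord_inj (can_inj (pairingK false))).

Lemma inv_alt_min a b :
  ((a, b) \in inversions alt_min) = odd a && (b == a.+1 :> nat).
Proof.
rewrite inv_pairE !permE /=; case: ltnP => [ab|]; last by lia.
by rewrite paired_lt // eqb_id.
Qed.

Lemma inv_alt_max a b :
  ((a, b) \in inversions alt_max) = (a < b) && (odd a || (b != a.+1 :> nat)).
Proof.
rewrite inv_pairE !permE /=; case: ltnP => //= ab.
have := @paired_lt false a b ab (ltn_ord b).
have := paired_subproof false a; have := paired_subproof false b.
have : paired false a != paired false b.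
  apply: contraTneq ab => /(congr1 (paired false)).
  by rewrite !pairedK // => ->; rewrite ltnn.
lia.
Qed.

(** Only adjacent pairs decide whether [w] is alternating, and [alt_min] and
[alt_max] agree with each other on these and differ on all other pairs. *)
Lemma alternating_interval w :
  alternating w =
    (inversions alt_min \subset inversions w) &&
    (inversions w \subset inversions alt_max).
Proof.
apply/alternatingP/andP => [altw|[/subsetP minw /subsetP wmax] i j ij].
  split; apply/subsetP => -[a b].
    by rewrite inv_alt_min => /andP[odda /eqP/altw ->].
  rewrite inv_alt_max => abw; have := abw; rewrite inv_pairE => /andP[-> _] /=.
  by case: eqP => [/altw|]; rewrite ?orbT // abw => <-.
apply/idP/idP => [/wmax|oddi].
  by rewrite inv_alt_max ij eqxx orbF => /andP[].
by apply: minw; rewrite inv_alt_min oddi ij eqxx.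
Qed.

Lemma alternating_alt_min : alternating alt_min.
Proof.
by apply/alternatingP => i j ij; rewrite inv_alt_min ij eqxx andbT.
Qed.

Lemma alternating_alt_max : alternating alt_max.
Proof.
by apply/alternatingP => i j ij; rewrite inv_alt_max ij eqxx orbF ltnSn.
Qed.

(** For a fixed second entry [j] there are [j.-1] pairs. *)
Lemma card_far_pairs :
  #|[set p : 'I_n * 'I_n | p.1.+1 < p.2]| = 'C(n.-1, 2).
Proof.
transitivity (\sum_(j < n) j.-1).
  rewrite -sum1_card.
  rewrite (eq_bigl (fun p : 'I_n * 'I_n => true && (p.1.+1 < p.2))); last first.
    by move=> p; rewrite inE.
  rewrite -(pair_big_dep predT (fun i j : 'I_n => i.+1 < j) (fun _ _ => 1)) /=.
  rewrite (exchange_big_dep predT) //=; apply: eq_bigr => j _.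
  rewrite (eq_bigl (fun i : 'I_n => i < j.-1)) => [|i]; last by lia.
  rewrite -(big_ord_widen _ (fun=> 1)).
    by rewrite sum_nat_const card_ord muln1.
  by have := ltn_ord j; lia.
case: {+}n => [|m]; first by rewrite big_ord0.
by rewrite big_ord_recl add0n -bin2_sum big_mkord.
Qed.

Definition alt_rank w : nat := #|inversions w :\: inversions alt_min|.

Lemma alt_rank_max : alt_rank alt_max = 'C(n.-1, 2).
Proof.
rewrite -card_far_pairs; apply: eq_card => -[a b].
by rewrite !inE -!inv_pairE inv_alt_min inv_alt_max /=; lia.
Qed.

Lemma block_lo_subproof (k : 'I_n./2) : k.*2 < n.
Proof. by have := ltn_ord k; lia. Qed.

Lemma block_hi_subproof (k : 'I_n./2) : k.*2.+1 < n.
Proof. by have := ltn_ord k; lia. Qed.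

(** The positions of the values [2k] and [2k+1] in [alt_min], which is an
involution. *)
Definition atom_pair (k : 'I_n./2) : 'I_n * 'I_n :=
  (pairing true (Ordinal (block_lo_subproof k)),
   pairing true (Ordinal (block_hi_subproof k))).

Lemma atom_pair_inj : injective atom_pair.
Proof.
move=> k l [] /(congr1 (paired true)).
rewrite !pairedK ?block_lo_subproof // => /double_inj kl _.
exact: val_inj.
Qed.

Lemma atom_pair_lt k : (atom_pair k).1 < (atom_pair k).2.
Proof. by have := ltn_ord k; rewrite /= /paired; repeat case: ifP; lia. Qed.

(** The two positions are [2k-1] and [2k+2], or [0] on the left if [k = 0], or
[2k+1] on the right if [2k+1] is the largest value.  They are adjacent only if
both exceptions occur at once, that is for [n = 2]. *)
Lemma atom_pair_far k : n <> 2 -> (atom_pair k).1.+1 < (atom_pair k).2.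
Proof. by have := ltn_ord k; rewrite /= /paired; repeat case: ifP; lia. Qed.

Definition selects_block (J : {set 'I_n./2}) (m : nat) :=
  [exists k in J, k == m :> nat].

Lemma selects_block_lt J m : selects_block J m -> m < n./2.
Proof. by case/exists_inP => k _ /eqP <-. Qed.

(** The block [m] consists of the values [2m] and [2m+1]. *)
Definition swap_blocks J i : 'I_n :=
  if selects_block J i./2 then pairing false i else i.

Lemma swap_blocksK J : involutive (swap_blocks J).
Proof.
move=> i; rewrite /swap_blocks.
case Ji: (selects_block J i./2); last by rewrite /= Ji.
have lt_i := selects_block_lt Ji.
have halfE : (paired false i)./2 = i./2.
  by move: lt_i; rewrite /paired; repeat case: ifP; lia.
by rewrite /= halfE Ji pairingK.
Qed.

(** Blocks are intervals of values, so permuting inside the blocks keeps the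
order between values of different blocks. *)
Lemma swap_blocks_lt J i j : (swap_blocks J j < swap_blocks J i) =
  if (i./2 == j./2) && selects_block J i./2 then i < j else j < i.
Proof.
have := @selects_block_lt J i./2; have := @selects_block_lt J j./2.
rewrite /swap_blocks; have [eij|] := eqVneq i./2 j./2.
  rewrite eij; case: selects_block => //= /(_ isT) lt_j _.
  by rewrite /paired; repeat case: ifP; lia.
case: (selects_block J i./2) => /=; case: (selects_block J j./2);
  by rewrite /= /paired; repeat case: ifP; lia.
Qed.

Definition alt_join J : 'S_n := (alt_min * perm (can_inj (swap_blocksK J)))%g.

Lemma inv_alt_join J :
  inversions (alt_join J) = inversions alt_min :|: atom_pair @: J.
Proof.
apply/setP => -[a b]; rewrite in_setU inv_alt_min inv_pairE !permM !permE.
rewrite swap_blocks_lt; have [/imsetP[k kJ abk]|abJ] := boolP (_ \in _ @: _).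
  have := atom_pair_lt k; rewrite -abk /= => ->.
  move: abk => [-> ->].
  rewrite !pairedK ?block_hi_subproof ?block_lo_subproof //.
  rewrite doubleK /= uphalf_double eqxx.
  by rewrite /selects_block orbT ltnSn; case: exists_inP => // -[]; exists k.
rewrite orbF; have [ab|] := ltnP a b => /=; last by lia.
have [/andP[/eqP xy Jx]|_] := ifPn; last by rewrite paired_lt // eqb_id.
have lt_x := selects_block_lt Jx; have [k kJ /eqP kx] := exists_inP Jx.
have ltab := paired_lt true ab (ltn_ord b).
rewrite /= in xy kx lt_x *.
have [lt_xy|] := ltnP; last first.
  by move: xy (ltn_ord b); rewrite /paired; repeat case: ifP; lia.
case/negP: abJ; apply/imsetP; exists k => //.
rewrite -[a](pairingK true) -[b](pairingK true).
by congr (pairing _ _, pairing _ _); apply: val_inj => /=; lia.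
Qed.

Lemma alternating_alt_join J : n <> 2 -> alternating (alt_join J).
Proof.
move=> n2; rewrite alternating_interval inv_alt_join subsetUl subUset.
have := alternating_alt_min; rewrite alternating_interval => /andP[_ ->] /=.
apply/subsetP => _ /imsetP[k _ ->].
have := atom_pair_far k n2; case: (atom_pair k) => a b /=.
by rewrite inv_alt_max; lia.
Qed.

Lemma alt_rank_join J : n <> 2 -> alt_rank (alt_join J) = #|J|.
Proof.
move=> n2; rewrite /alt_rank inv_alt_join setDUl setDv set0U.
rewrite -(card_imset _ atom_pair_inj); congr #|pred_of_set _|.
apply/setDidPl; rewrite disjoint_sym; apply/pred0P=> -[a b] /=.
apply/negP => /andP[]; rewrite inv_alt_min => minab /imsetP[k _ kab].
by have := atom_pair_far k n2; rewrite -kab /=; move: minab; lia.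
Qed.

Definition atoms_below w := [set k | atom_pair k \in inversions w].

Lemma alt_join_le J w : alternating w ->
  (inversions (alt_join J) \subset inversions w) = (J \subset atoms_below w).
Proof.
rewrite alternating_interval inv_alt_join subUset => /andP[-> _] /=.
by rewrite sub_imset_pre; congr (_ \subset _); apply/setP => k; rewrite !inE.
Qed.

(** The values [i = 2k+1] and [i+1] of [alt_min] stand at adjacent positions that
every alternating permutation inverts, and the values [2k] and [2k+1] stand at
[atom_pair k]; if [w] inverts no [atom_pair k], it thus agrees with [alt_min] on
the order of all pairs of positions holding consecutive values. *)
Lemma atoms_below_eq0 w : alternating w -> atoms_below w = set0 -> alt_min = w.
Proof.
move=> altw w0; apply: eq_perm_adj_lt => i j ij.
have minV x : (alt_min^-1)%g x = pairing true x.
  by apply: (perm_inj (s := alt_min)); rewrite permKV permE pairingK.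
rewrite !minV; case: (boolP (odd i)) => oddi.
  have -> : pairing true i = j.
    apply: val_inj; have := ltn_ord j.
    by rewrite /= /paired; repeat case: ifP; lia.
  have -> : pairing true j = i.
    apply: val_inj; have := ltn_ord j.
    by rewrite /= /paired; repeat case: ifP; lia.
  by have := alternatingP _ altw i j ij; rewrite oddi inv_pairE => /andP[].
have lt_k : i./2 < n./2 by have := ltn_ord j; lia.
have : Ordinal lt_k \notin atoms_below w by rewrite w0 inE.
have := atom_pair_lt (Ordinal lt_k); rewrite inE /atom_pair.
have -> : Ordinal (block_lo_subproof (Ordinal lt_k)) = i.
  by apply: val_inj => /=; lia.
have -> : Ordinal (block_hi_subproof (Ordinal lt_k)) = j.
  by apply: val_inj => /=; lia.
move=> lt_ij; rewrite inv_pairE lt_ij /= => nwji.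
by rewrite perm_lt_total // -val_eqE /= ltn_eqF.
Qed.

End AlternatingInterval.

Section AlternatingPoset.
Variable n : nat.
Implicit Types x y z : Alt n.
Local Open Scope order_scope.

Lemma Alt_le_inv x y :
  (x <= y) = (inversions (val x) \subset inversions (val y)).
Proof. by rewrite Alt_leE weak_le_inv. Qed.

Definition Alt_bot : Alt n :=
  exist _ (alt_min n : weakS n) (alternating_alt_min n).
Definition Alt_top : Alt n :=
  exist _ (alt_max n : weakS n) (alternating_alt_max n).

Lemma Alt_botP : is_bottom Alt_bot.
Proof.
apply/forallP => x; rewrite Alt_le_inv.
by have := valP x; rewrite alternating_interval => /andP[].
Qed.

Lemma Alt_topP x : x <= Alt_top.
Proof.
rewrite Alt_le_inv.
by have := valP x; rewrite alternating_interval => /andP[].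
Qed.

(** An upward step from [x] towards [y] stays in the interval of alternating
permutations, so it reaches [y] if [y] covers [x]. *)
Lemma Alt_rankP : is_rank Alt_bot (fun x => alt_rank (val x)).
Proof.
split=> [|x y].
  by rewrite /alt_rank setDv cards0.
rewrite /covers => /andP[xy /forallP xyC].
have neq_xy : val x != val y by rewrite (inj_eq val_inj) lt_eqF.
have leq_xy : inversions (val x) \subset inversions (val y).
  by rewrite -Alt_le_inv ltW.
have [s [p [_ px sx sxy]]] := inv_subset_step leq_xy neq_xy.
have altz : alternating (val x * s)%g.
  have := valP x; have := valP y; rewrite !alternating_interval.
  case/andP=> _ y_max /andP[min_x _]; rewrite (subset_trans sxy) // andbT.
  by rewrite sx (subset_trans min_x) // subsetUr.
pose z : Alt n := exist _ (val x * s : weakS n)%g altz.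
have zy : z = y.
  have := xyC z; rewrite lt_neqAle [z < y]lt_neqAle.
  rewrite !Alt_le_inv sxy /= sx subsetUr.
  rewrite !andbT negb_and !negbK => /orP[/eqP xz|/eqP //].
  by case/negP: px; rewrite [in X in inversions X]xz /= sx setU11.
have min_x : inversions (alt_min n) \subset inversions (val x).
  by have := valP x; rewrite alternating_interval => /andP[].
rewrite -zy /alt_rank /= sx setDUl.
have -> : [set p] :\: inversions (alt_min n) = [set p].
  apply/setDidPl; rewrite disjoints1.
  exact: contra (subsetP min_x p) px.
by rewrite cardsU1 in_setD (negPf px) andbF.
Qed.

End AlternatingPoset.

(** * The characteristic polynomial *)

Local Open Scope ring_scope.

Theorem theorem1p1 (n : nat) (n_gt0 : (0 < n)%N) (n_neq2 : n <> 2%N) :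
  is_char_poly (Alt n)
    ('X ^+ ('C(n.-1, 2) - n./2) * ('X - 1) ^+ n./2).
Proof.
pose join J : Alt n :=
  exist _ (alt_join J : weakS n) (alternating_alt_join J n_neq2).
rewrite -alt_rank_max -[n./2]card_ord.
apply: (@char_poly_of_boolean_joins _ _ (Alt_bot n) (Alt_top n) _ _ join
          (fun x => atoms_below (val x))
          (Alt_botP n) (@Alt_topP n) (Alt_rankP n)).
- by move=> J y; rewrite Alt_le_inv alt_join_le // (valP y).
- by move=> y /atoms_below_eq0 miny; apply: val_inj; rewrite -miny // (valP y).
- by move=> J; apply: alt_rank_join.
Qed.
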